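(* Let $p\ge1$ and $n\ge2$ be integers, and let $\mathfrak{G}\subset\Bbbk^{n^2p}$ be the Gelfand-Tsetlin variety for $Y_p(\mathfrak{gl}_n)$. Then $$\mathfrak{G}=\bigcup_{s=1}^{p+1}\mathfrak{G}_s,$$ where $$\mathfrak{G}_1:=V\left(\{p_{ij}\}_{i=1,2;\ 1\le j\le p}\cup\{X_{12}^{(i)}\}_{i=1}^{p}\cup\{p_{ij}\}_{3\le i\le n,\ 1\le j\le ip}\right)\subset\Bbbk^{n^2p},$$ for $2\le s\le p$, $$\mathfrak{G}_s:=V\left(\{p_{ij}\}_{i=1,2;\ 1\le j\le p}\cup\{X_{12}^{(i)}\}_{i=s}^{p}\cup\{X_{21}^{(i)}\}_{i=p-(s-2)}^{p}\cup\{p_{ij}\}_{3\le i\le n,\ 1\le j\le ip}\right)\subset\Bbbk^{n^2p},$$ and $$\mathfrak{G}_{p+1}:=V\left(\{p_{ij}\}_{i=1,2;\ 1\le j\le p}\cup\{X_{21}^{(i)}\}_{i=1}^{p}\cup\{p_{ij}\}_{3\le i\le n,\ 1\le j\le ip}\right)\subset\Bbbk^{n^2p}.$$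
   Context: $\Bbbk$ is an algebraically closed field of characteristic zero; $V(S)$ denotes the zero set in affine space of a set $S$ of polynomials. The associated graded algebra of the restricted Yangian $Y_p(\mathfrak{gl}_n)$ of level $p$ is the polynomial algebra in the variables $X_{ij}^{(k)}$, $1\le i,j\le n$, $1\le k\le p$, which are taken as coordinates on $\Bbbk^{n^2p}$. Put $X_{ij}(u)=\delta_{ij}u^p+\sum_{k=1}^pX_{ij}^{(k)}u^{p-k}$. For $1\le m\le n$ define polynomials $\overline{d}_{mj}$, $1\le j\le mp$, by $$\det\left(X_{ij}(u)\right)_{i,j=1}^m=u^{mp}+\overline{d}_{m1}u^{mp-1}+\cdots+\overline{d}_{m,mp}$$ (these are the graded images of the coefficients of the quantum determinants of $Y_p(\mathfrak{gl}_m)$). The Gelfand-Tsetlin variety for $Y_p(\mathfrak{gl}_n)$ is $\mathfrak{G}:=V(\{\overline{d}_{ij}\}_{1\le i\le n,\ 1\le j\le ip})\subset\Bbbk^{n^2p}$. Polynomials $p_{ij}$ ($1\le i\le n$, $1\le j\le ip$): $p_{1j}=X_{11}^{(j)}$ for $1\le j\le p$. $p_{2j}=X_{22}^{(j)}-\sum_{t=1}^{j-1}X_{12}^{(t)}X_{21}^{(j-t)}$ for $1\le j\le p$ (so $p_{21}=X_{22}^{(1)}$), and $p_{2,p+j}=\sum_{t=j}^{p}X_{12}^{(t)}X_{21}^{(p+j-t)}$ for $1\le j\le p$. For $1\le j\le 3p$, $$p_{3j}=\epsilon_j-\sum_{\substack{s+t=j\\1\le s,t\le p}}\left(X_{13}^{(s)}X_{31}^{(t)}+X_{23}^{(s)}X_{32}^{(t)}\right)+\sum_{\substack{r+s+t=j\\1\le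 r,s,t\le p}}\left(X_{12}^{(r)}X_{23}^{(s)}X_{31}^{(t)}+X_{13}^{(r)}X_{21}^{(s)}X_{32}^{(t)}\right)-\sum_{\substack{r+s+t=j\\1\le r,s,t\le p}}X_{13}^{(r)}X_{22}^{(s)}X_{31}^{(t)},$$ where $\epsilon_j=X_{33}^{(j)}$ if $j\le p$ and $\epsilon_j=0$ if $j>p$, and where in the last sum the terms with $s=1$ are omitted when $j\le p+1$. For $4\le i\le n$ and $1\le j\le ip$, $p_{ij}=\overline{d}_{ij}$. *)

(* Defs.v *)
From mathcomp Require Import all_boot all_algebra.
From mathcomp Require Import mpoly.
From mathcomp Require Import classical_sets.

Set Implicit Arguments.
Unset Strict Implicit.
Unset Printing Implicit Defensive.

Import GRing.Theory.
Local Open Scope classical_set_scope.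
Local Open Scope ring_scope.

Definition zero_locus (K : comNzRingType) (N : nat) (S : set {mpoly K[N]}) :
  set ('I_N -> K) := [set x | forall f, S f -> f.@[x] = 0].

Section GelfandTsetlin.
Variables (K : fieldType) (n p : nat).

(* The triple (a, b, c) of ordinals labels the variable X_{a+1,b+1}^{(c+1)}. *)
Definition gt_label : finType := ('I_n * 'I_n * 'I_p)%type.

(* N = n^2 p *)
Definition gt_dim : nat := #|gt_label|.

Definition gt_ring := {mpoly K[gt_dim]}.

(* X_{ij}^{(k)} with 1-based indices 1 <= i, j <= n and 1 <= k <= p; the value
   is 0 for indices outside these ranges. *)
Definition gtX (i j k : nat) : gt_ring :=
  if [pick t : gt_label | [&& t.1.1.+1 == i, t.1.2.+1 == j & t.2.+1 == k]]
    is Some t then 'X_(enum_rank t) else 0.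

Definition gtXu (i j : nat) : {poly gt_ring} :=
  (i == j)%:R * 'X^p + \sum_(1 <= k < p.+1) (gtX i j k)%:P * 'X^(p - k).

Definition dbar (m j : nat) : gt_ring :=
  (\det (\matrix_(a < m, b < m) gtXu a.+1 b.+1))`_(m * p - j).

Definition gt_p1 (j : nat) : gt_ring := gtX 1 1 j.

(* For j > p the second branch is p_{2,p+j'} with j' = j - p, so that the lower
   bound is j' and the superscript p + j' - t is j - t. *)
Definition gt_p2 (j : nat) : gt_ring :=
  if (j <= p)%N then gtX 2 2 j - \sum_(1 <= t < j) gtX 1 2 t * gtX 2 1 (j - t)
  else \sum_(j - p <= t < p.+1) gtX 1 2 t * gtX 2 1 (j - t).

Definition gt_p3 (j : nat) : gt_ring :=
  (if (j <= p)%N then gtX 3 3 j else 0)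
  - (\sum_(1 <= s < p.+1) \sum_(1 <= t < p.+1 | (s + t == j)%N)
       (gtX 1 3 s * gtX 3 1 t + gtX 2 3 s * gtX 3 2 t))
  + (\sum_(1 <= r < p.+1) \sum_(1 <= s < p.+1)
       \sum_(1 <= t < p.+1 | (r + s + t == j)%N)
       (gtX 1 2 r * gtX 2 3 s * gtX 3 1 t + gtX 1 3 r * gtX 2 1 s * gtX 3 2 t))
  - (\sum_(1 <= r < p.+1)
       \sum_(1 <= s < p.+1 | ~~ ((s == 1)%N && (j <= p.+1)%N))
       \sum_(1 <= t < p.+1 | (r + s + t == j)%N)
       gtX 1 3 r * gtX 2 2 s * gtX 3 1 t).

Definition gt_p (i j : nat) : gt_ring :=
  match i with
  | 1 => gt_p1 j
  | 2 => gt_p2 j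
  | 3 => gt_p3 j
  | _ => dbar i j
  end.

Definition GT_variety : set ('I_gt_dim -> K) :=
  zero_locus [set f | exists i j : nat,
    [/\ (1 <= i <= n)%N, (1 <= j <= i * p)%N & f = dbar i j]].

Definition gt_polys12 : set gt_ring :=
  [set f | exists i j : nat,
    [/\ (1 <= i <= 2)%N, (1 <= j <= p)%N & f = gt_p i j]].

Definition gt_polys3n : set gt_ring :=
  [set f | exists i j : nat,
    [/\ (3 <= i <= n)%N, (1 <= j <= i * p)%N & f = gt_p i j]].

(* {X_{ab}^{(i)} : l <= i <= p} *)
Definition gt_vars (a b l : nat) : set gt_ring :=
  [set gtX a b i | i in [set i : nat | (l <= i <= p)%N]].

Definition GT_component (s : nat) : set ('I_gt_dim -> K) :=
  if s == 1%N then
    zero_locus (gt_polys12 `|` gt_vars 1 2 1 `|` gt_polys3n)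
  else if s == p.+1 then
    zero_locus (gt_polys12 `|` gt_vars 2 1 1 `|` gt_polys3n)
  else
    zero_locus (gt_polys12 `|` gt_vars 1 2 s `|` gt_vars 2 1 (p - (s - 2))
                `|` gt_polys3n).

End GelfandTsetlin.

Arguments GT_variety : clear implicits.
Arguments GT_component : clear implicits.

(* Main.v *)
Require Import Defs.
From mathcomp Require Import all_boot all_algebra.
From mathcomp Require Import mpoly.
From mathcomp Require Import classical_sets.
From mathcomp Require Import zify ring.

(* At a point of the affine space write X_ij(u) = [i = j] u^p + P_ij(u) with
   deg P_ij < p.  The equations of the 1 x 1 and 2 x 2 minors say P_11 = 0 and
   u^p P_22 = P_12 P_21.  Comparing coefficients, the second identity consists
   of the equations p_2j = 0 for j <= p (degrees >= p) and of the divisibility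
   u^p | P_12 P_21 (degrees < p); the latter holds iff u^b | P_12 and
   u^(p-b) | P_21 for some 0 <= b <= p, and b = p + 1 - s gives the s-th
   component.  Modulo these two identities the 3 x 3 minor expands to
   u^(3p) plus the generating polynomial of the p_3j. *)

Set Implicit Arguments.
Unset Strict Implicit.
Unset Printing Implicit Defensive.

Import GRing.Theory.
Local Open Scope classical_set_scope.
Local Open Scope ring_scope.

(** * Explicit determinants of sizes 2 and 3 *)

Lemma det_mx22 (R : comNzRingType) (M : 'M[R]_2) :
  \det M = M 0 0 * M 1 1 - M 0 1 * M 1 0.
Proof.
rewrite (expand_det_row _ 0) !big_ord_recl big_ord0 /cofactor !det_mx11 !mxE /=.
have -> : lift 0 0 = 1 :> 'I_2 by exact: val_inj.
have -> : lift 1 0 = 0 :> 'I_2 by exact: val_inj.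
by rewrite addr0 expr0 expr1 mul1r mulN1r mulrN.
Qed.

Lemma det_mx33 (R : comNzRingType) (M : 'M[R]_3) :
  \det M = M 0 0 * (M 1 1 * M 2%:R 2%:R - M 1 2%:R * M 2%:R 1)
         - M 0 1 * (M 1 0 * M 2%:R 2%:R - M 1 2%:R * M 2%:R 0)
         + M 0 2%:R * (M 1 0 * M 2%:R 1 - M 1 1 * M 2%:R 0).
Proof.
rewrite (expand_det_row _ 0) !big_ord_recl big_ord0 /cofactor !det_mx22 !mxE /=.
have -> : lift 0 0 = 1 :> 'I_3 by exact: val_inj.
have -> : lift 0 1 = 2%:R :> 'I_3 by exact: val_inj.
have -> : lift 1 0 = 0 :> 'I_3 by exact: val_inj.
have -> : lift 1 1 = 2%:R :> 'I_3 by exact: val_inj.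
have -> : lift ord0 (lift ord0 ord0) = 2%:R :> 'I_3 by exact: val_inj.
have -> : lift 2%:R 0 = 0 :> 'I_3 by exact: val_inj.
have -> : lift 2%:R 1 = 1 :> 'I_3 by exact: val_inj.
rewrite /bump /=; ring.
Qed.

(** * Generating polynomials in u and the coefficients of their products *)

Section ReversedPoly.
Variables (K : fieldType) (p : nat).
Implicit Types (c d e : nat -> K) (B C : {poly K}).

(** The part of $X_{ij}(u)$ below $u^p$. The leading term is kept apart so that the degree stays
    below p, on and off the diagonal. *)
Definition rev_poly c : {poly K} := \sum_(1 <= k < p.+1) c k *: 'X^(p - k).

(** Coefficients are counted down from degree [N + p], so that [j] is the total superscript, as in
    the formulas for $p_{ij}$. The factor ['X^N] stands for the diagonal terms $u^p$ in a
    product. *)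
Lemma coef_XnM_rev_poly N c j : (j <= N + p)%N ->
  ('X^N * rev_poly c)`_(N + p - j) = \sum_(1 <= k < p.+1 | (k == j)%N) c k.
Proof.
move=> le_j; rewrite mulr_sumr coef_sum big_mkcond /= [RHS]big_mkcond /=.
apply: eq_big_nat => k /andP[k1 kp].
rewrite -scalerAr coefZ -exprD coefXn.
have -> : (N + p - j == N + (p - k))%N = (k == j) by lia.
by case: eqP => _; rewrite ?mulr1 ?mulr0.
Qed.

Lemma coef_XnM_rev_poly2 N c d j : (j <= N + (p + p))%N ->
  ('X^N * (rev_poly c * rev_poly d))`_(N + (p + p) - j) =
  \sum_(1 <= s < p.+1) \sum_(1 <= t < p.+1 | (s + t == j)%N) c s * d t.
Proof.
move=> le_j; rewrite mulr_suml mulr_sumr coef_sum.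
apply: eq_big_nat => s /andP[s1 sp].
rewrite mulr_sumr mulr_sumr coef_sum [RHS]big_mkcond /=.
apply: eq_big_nat => t /andP[t1 tp].
rewrite -scalerAl -!scalerAr !coefZ -!exprD coefXn.
have -> : (N + (p + p) - j == N + (p - s + (p - t)))%N = (s + t == j)%N by lia.
by case: eqP => _; rewrite ?mulr1 ?mulr0.
Qed.

Lemma coef_rev_poly3 c d e j : (j <= p + (p + p))%N ->
  (rev_poly c * rev_poly d * rev_poly e)`_(p + (p + p) - j) =
  \sum_(1 <= r < p.+1) \sum_(1 <= s < p.+1)
    \sum_(1 <= t < p.+1 | (r + s + t == j)%N) c r * d s * e t.
Proof.
move=> le_j; rewrite -mulrA mulr_suml coef_sum.
apply: eq_big_nat => r /andP[r1 rp].
rewrite mulr_suml mulr_sumr coef_sum.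
apply: eq_big_nat => s /andP[s1 sp].
rewrite mulr_sumr mulr_sumr coef_sum [RHS]big_mkcond /=.
apply: eq_big_nat => t /andP[t1 tp].
rewrite -!scalerAl -!scalerAr !coefZ -!exprD coefXn.
have -> : (p + (p + p) - j == p - r + (p - s + (p - t)))%N =
          (r + s + t == j)%N by lia.
by case: eqP => _; rewrite ?mulr1 ?mulr0 ?mulrA.
Qed.

Lemma sum_nat_pick (F : nat -> K) j :
  \sum_(1 <= k < p.+1 | (k == j)%N) F k = if (0 < j <= p)%N then F j else 0.
Proof.
rewrite big_mkcond /=; case: ifP => j_range.
  rewrite (bigD1_seq j) ?mem_index_iota ?iota_uniq //= eqxx big1 ?addr0 //.
  by move=> k /negPf->.
rewrite big1_seq // => k; rewrite mem_index_iota /= => k_range.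
by case: eqP => // kj; move: j_range k_range; rewrite kj ltnS => ->.
Qed.

Lemma coef_rev_poly c k : (k < p)%N -> (rev_poly c)`_k = c (p - k)%N.
Proof.
move=> lt_kp; have := @coef_XnM_rev_poly 0 c (p - k) (leq_subr _ _).
rewrite mul1r add0n subKn 1?ltnW // => ->.
by rewrite sum_nat_pick subn_gt0 lt_kp leq_subr.
Qed.

Lemma coef_rev_poly_sub c k : (0 < k <= p)%N -> (rev_poly c)`_(p - k) = c k.
Proof.
by move=> /andP[k_gt0 le_kp]; rewrite coef_rev_poly ?subKn // ltn_subrL k_gt0; lia.
Qed.

Lemma size_rev_poly c : (size (rev_poly c) <= p)%N.
Proof.
apply/leq_sizeP => j le_pj; rewrite coef_sum big1_seq // => k.
rewrite mem_index_iota /= => k_range; rewrite coefZ coefXn.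
by case: eqP => [|_]; [lia | rewrite mulr0].
Qed.

Lemma size_XnM_rev_poly_sub c d e :
  (size ('X^p * rev_poly c - rev_poly d * rev_poly e)%R <= p + p)%N.
Proof.
rewrite (leq_trans (size_polyD _ _)) // geq_max size_polyN.
have := (size_rev_poly c, size_rev_poly d, size_rev_poly e) => -[[sc sd] se].
apply/andP; split; apply: leq_trans (size_polyMleq _ _) _.
  by rewrite size_polyXn leq_add2l.
exact: leq_trans (leq_pred _) (leq_add sd se).
Qed.

Lemma rev_poly_eq0 c :
  (forall k, (0 < k <= p)%N -> c k = 0) -> rev_poly c = 0.
Proof.
by move=> c0; rewrite /rev_poly big1_seq // => k; rewrite mem_index_iota /= => ?;
   rewrite c0 ?scale0r.
Qed.

End ReversedPoly.

(** * Order of vanishing at 0 of a product of two polynomials *)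

Section LowCoefficients.
Variable K : fieldType.
Implicit Types B C : {poly K}.

Lemma coef_mul_low0 B C a b k :
  (forall i, (i < a)%N -> B`_i = 0) -> (forall i, (i < b)%N -> C`_i = 0) ->
  (k < a + b)%N -> (B * C)`_k = 0.
Proof.
move=> B0 C0 lt_k; rewrite coefM big1 // => -[i /= le_ik] _.
have [/B0 ->|le_ai] := ltnP i a; first by rewrite mul0r.
by rewrite C0 ?mulr0 //; lia.
Qed.

(** Strong induction on [k]: in the coefficient of degree [b + k] of [B * C], indices below [b] kill
    the factor from [B] and indices above [b] kill the factor from [C], which leaves [B]_b *
    C[_k]. *)
Lemma low_coef_cofactor0 B C N b :
    (forall k, (k < N)%N -> (B * C)`_k = 0) ->
    (forall i, (i < b)%N -> B`_i = 0) -> B`_b != 0 ->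
  forall k, (k < N - b)%N -> C`_k = 0.
Proof.
move=> BC0 B0 Bb; elim/ltn_ind => k IHk lt_k.
have lt_b : (b < (b + k).+1)%N by rewrite ltnS leq_addr.
have /eqP := BC0 (b + k)%N ltac:(lia).
rewrite coefM (bigD1 (Ordinal lt_b)) //= addKn big1 ?addr0.
  by rewrite mulf_eq0 (negPf Bb) => /eqP.
move=> -[i /= le_i] ne_i; have {}ne_i : i != b by [].
have [/B0 ->|le_bi] := ltnP i b; first by rewrite mul0r.
by rewrite IHk ?mulr0 //; lia.
Qed.

(** The witness [b] is the order of vanishing of [B] at 0, cut off at [N]. *)
Lemma low_coef_mul_split B C N :
  (forall k, (k < N)%N -> (B * C)`_k = 0) ->
  exists2 b, (b <= N)%N & (forall i, (i < b)%N -> B`_i = 0) /\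
                          (forall i, (i < N - b)%N -> C`_i = 0).
Proof.
move=> BC0; have [/forallP B0|] := boolP [forall i : 'I_N, B`_i == 0].
  exists N => //; split=> i; last by rewrite subnn.
  by move=> lt_i; apply/eqP/(B0 (Ordinal lt_i)).
rewrite negb_forall => /existsP[[i0 /= lt_i0] Bi0].
have ex_nz : exists i, B`_i != 0 by exists i0.
case: (ex_minnP ex_nz) => b Bb min_b; exists b.
  exact: leq_trans (min_b _ Bi0) (ltnW lt_i0).
have B0 i : (i < b)%N -> B`_i = 0.
  by move=> lt_ib; apply/eqP/negPn/negP => /min_b; rewrite leqNgt lt_ib.
by split=> //; apply: low_coef_cofactor0 BC0 B0 Bb.
Qed.

Lemma coef_Xn_add_low0 N (q : {poly K}) : (size q <= N)%N ->
  (forall k, (k < N)%N -> ('X^N + q)`_k = 0) -> q = 0.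
Proof.
move=> sz_q q0; apply/polyP => k; rewrite coef0.
have [lt_k|le_k] := ltnP k N; last by rewrite nth_default // (leq_trans sz_q).
by have := q0 k lt_k; rewrite coefD coefXn ltn_eqF // add0r.
Qed.

End LowCoefficients.

(** * Evaluation of the minors and of the $p_{ij}$ at a fixed point *)

Section Points.
Variables (K : fieldType) (n p : nat) (x : 'I_(gt_dim n p) -> K).

Let c i j k : K := (gtX K n p i j k).@[x].
Let P i j : {poly K} := rev_poly p (c i j).

Lemma map_gtXu i j :
  map_poly (meval x) (gtXu K n p i j) = (i == j)%:R * 'X^p + P i j.
Proof.
rewrite /gtXu rmorphD rmorphM rmorph_nat /= map_polyXn; congr (_ + _).
rewrite rmorph_sum /=; apply: eq_bigr => k _.
by rewrite rmorphM /= map_polyXn map_polyC /= mul_polyC.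
Qed.

Lemma meval_dbar m j :
  (dbar K n p m j).@[x] =
  (\det (\matrix_(a < m, b < m) ((a == b)%:R * 'X^p + P a.+1 b.+1))
     : {poly K})`_(m * p - j).
Proof.
rewrite /dbar -(coef_map (meval x)) -det_map_mx; congr (nth 0 (polyseq (\det _)) _).
by apply/matrixP => a b; rewrite !mxE; exact: map_gtXu.
Qed.

Lemma meval_dbar1 j :
  (dbar K n p 1 j).@[x] = ('X^p + P 1 1)`_(p - j).
Proof. by rewrite meval_dbar det_mx11 !mxE mul1r mul1n. Qed.

Lemma meval_dbar2 j :
  (dbar K n p 2 j).@[x] =
  (('X^p + P 1 1) * ('X^p + P 2 2) - P 1 2 * P 2 1)`_(p + p - j).
Proof.
by rewrite meval_dbar det_mx22 !mxE /= !mul1r !mul0r !add0r mul2n addnn.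
Qed.

Lemma meval_dbar3 j : (dbar K n p 3 j).@[x] =
  (('X^p + P 1 1) * (('X^p + P 2 2) * ('X^p + P 3 3) - P 2 3 * P 3 2)
   - P 1 2 * (P 2 1 * ('X^p + P 3 3) - P 2 3 * P 3 1)
   + P 1 3 * (P 2 1 * P 3 2 - ('X^p + P 2 2) * P 3 1))`_(p + (p + p) - j).
Proof.
rewrite meval_dbar det_mx33 !mxE /= !mul1r !mul0r !add0r.
by rewrite (_ : 3 * p = p + (p + p))%N //; lia.
Qed.

Definition gt12_vanish := forall i j, (1 <= i <= 2)%N -> (1 <= j <= p)%N ->
  (gt_p K n p i j).@[x] = 0.

(* The part of the equations of the variety coming from the upper left 2 x 2
   block: X_11(u) = u^p and u^p (X_22(u) - u^p) = X_12(u) X_21(u). *)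
Definition gt12_poly_eq := P 1 1 = 0 /\ 'X^p * P 2 2 = P 1 2 * P 2 1.

(** Once $P_{11}=0$, the 2 x 2 minor is $u^{2p}+(u^pP_{22}-P_{12}P_{21})$, and the bracket has
    degree below 2p. *)
Lemma dbar12_vanishP :
  (forall m j, (1 <= m <= 2)%N -> (1 <= j <= m * p)%N ->
     (dbar K n p m j).@[x] = 0) <-> gt12_poly_eq.
Proof.
split=> [d0|[P11 P22] [|[|[|m]]] j //= _ j_range]; last first.
- rewrite meval_dbar2 P11 addr0 mulrDr P22 addrK -exprD coefXn.
  by case: eqP => //; lia.
- by rewrite meval_dbar1 P11 addr0 coefXn; case: eqP => //; lia.
have P11 : P 1 1 = 0.
  apply: (@coef_Xn_add_low0 _ p); first exact: size_rev_poly.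
  move=> k lt_k; have := d0 1 (p - k)%N isT ltac:(lia).
  by rewrite meval_dbar1 subKn // ltnW.
split=> //; apply/eqP; rewrite -subr_eq0; apply/eqP.
apply: (@coef_Xn_add_low0 _ (p + p)); first exact: size_XnM_rev_poly_sub.
move=> k lt_k; have := d0 2 (p + p - k)%N isT ltac:(lia).
by rewrite meval_dbar2 P11 subKn 1?ltnW // addr0 mulrDr -exprD addrA.
Qed.

(** For [j <= p] the condition [s + t = j] already keeps both indices below [p], so the upper bounds
    disappear. *)
Lemma sum_antidiag (F : nat -> nat -> K) j : (j <= p)%N ->
  \sum_(1 <= s < p.+1) \sum_(1 <= t < p.+1 | (s + t == j)%N) F s t =
  \sum_(1 <= s < j) F s (j - s)%N.
Proof.
case: j => [|j] lt_j.
  rewrite [RHS]big_geq // big1_seq // => s; rewrite mem_index_iota => s_range.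
  by rewrite big_pred0 // => t; lia.
rewrite (big_cat_nat (n := j.+1)) //=; last lia.
rewrite [X in _ + X]big1_seq ?addr0; last first.
  move=> s; rewrite mem_index_iota => s_range.
  rewrite big_mkcond big1_seq // => t; rewrite mem_index_iota => t_range.
  by case: eqP => //; lia.
apply: eq_big_nat => s s_range.
rewrite (eq_bigl (fun t => t == j.+1 - s)%N) => [|t]; last lia.
by rewrite sum_nat_pick ifT //; lia.
Qed.

Lemma meval_gt_p2 j : (1 <= j <= p)%N -> (gt_p2 K n p j).@[x] =
  ('X^p * P 2 2 - P 1 2 * P 2 1)`_(p + p - j).
Proof.
move=> j_range; rewrite /gt_p2 ifT; last lia.
rewrite coefB coef_XnM_rev_poly ?sum_nat_pick ?j_range; last lia.
have := @coef_XnM_rev_poly2 _ p 0 (c 1 2) (c 2 1) j ltac:(lia).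
rewrite mul1r => ->; rewrite sum_antidiag ?mevalB; last lia.
congr (_ - _); rewrite raddf_sum /=; apply: eq_bigr => t _.
by rewrite mevalM.
Qed.

(** The identity $u^pP_{22}=P_{12}P_{21}$ is split at degree p, below which its left side has no
    coefficients. *)
Lemma gt12_poly_eqP : gt12_poly_eq <->
  gt12_vanish /\ (forall k, (k < p)%N -> (P 1 2 * P 2 1)`_k = 0).
Proof.
split=> [[P11 P22]|[v BC0]].
  split=> [[|[|[|i]]] j //= _ j_range|k lt_k].
  - by rewrite -[LHS](coef_rev_poly_sub (c 1 1) j_range) -/(P 1 1) P11 coef0.
  - by rewrite meval_gt_p2 // P22 subrr coef0.
  - by rewrite -P22 coefXnM lt_k.
split; first by apply: rev_poly_eq0 => k k_range; apply: (v 1%N k).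
apply/eqP; rewrite -subr_eq0; apply/eqP.
(* Adding $u^{2p}$ does not affect the coefficients below degree 2p, which are the only ones left to
   check. *)
apply: (@coef_Xn_add_low0 _ (p + p)); first exact: size_XnM_rev_poly_sub.
move=> k lt_k; rewrite coefD coefXn ltn_eqF // add0r.
have [lt_kp|le_pk] := ltnP k p.
  by rewrite coefB coefXnM lt_kp BC0 // subr0.
have := v 2 (p + p - k)%N isT ltac:(lia).
by rewrite /= meval_gt_p2 ?subKn //; lia.
Qed.

(* On the 2 x 2 equations X_22^(1) vanishes, which is why the terms with s = 1
   can be dropped from the last sum of p_3j. *)
Lemma meval_gt_p3 j : gt12_poly_eq -> (1 <= j <= 3 * p)%N ->
  (gt_p3 K n p j).@[x] = (dbar K n p 3 j).@[x].
Proof.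
move=> eq12 j_range; have [v _] := gt12_poly_eqP.1 eq12.
have [P11 P22] := eq12.
have c221 : c 2 2 1 = 0.
  (* The range of [j] forces [p >= 1], so $p_{21}=X_{22}^{(1)}$ is among the equations. *)
  have := v 2 1 isT ltac:(lia); rewrite /= /gt_p2 ifT; last lia.
  by rewrite big_geq // subr0.
have le_j : (j <= p + (p + p))%N by lia.
rewrite meval_dbar3 P11 addr0.
(* The last summand isolates a multiple of the 2 x 2 equation, hence zero; the middle bracket
   matches $p_{3j}$ term by term. *)
have -> : 'X^p * (('X^p + P 2 2) * ('X^p + P 3 3) - P 2 3 * P 3 2)
   - P 1 2 * (P 2 1 * ('X^p + P 3 3) - P 2 3 * P 3 1)
   + P 1 3 * (P 2 1 * P 3 2 - ('X^p + P 2 2) * P 3 1) =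
  'X^p * ('X^p * 'X^p) + ('X^(p + p) * P 3 3
    - ('X^p * (P 1 3 * P 3 1) + 'X^p * (P 2 3 * P 3 2))
    + (P 1 2 * P 2 3 * P 3 1 + P 1 3 * P 2 1 * P 3 2)
    - P 1 3 * P 2 2 * P 3 1)
  + ('X^p * P 2 2 - P 1 2 * P 2 1) * ('X^p + P 3 3).
  rewrite exprD; ring.
rewrite P22 subrr mul0r addr0 coefD -!exprD coefXn ltn_eqF ?add0r; last lia.
rewrite !(coefD, coefN) !coef_XnM_rev_poly2 // !coef_rev_poly3 // addnA.
rewrite coef_XnM_rev_poly -?addnA // sum_nat_pick.
rewrite /gt_p3 !(mevalB, mevalD); congr (_ - _ + _ - _).
- by rewrite (fun_if (meval x)) meval0; case/andP: j_range => ->.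
- rewrite raddf_sum -big_split /=; apply: eq_bigr => s _.
  rewrite raddf_sum -big_split /=; apply: eq_bigr => t _.
  by rewrite mevalD !mevalM.
- rewrite raddf_sum -big_split /=; apply: eq_bigr => r _.
  rewrite raddf_sum -big_split /=; apply: eq_bigr => s _.
  rewrite raddf_sum -big_split /=; apply: eq_bigr => t _.
  by rewrite mevalD !mevalM.
rewrite raddf_sum /=; apply: eq_bigr => r _.
rewrite raddf_sum big_mkcond /=; apply: eq_bigr => s _.
case: ifP => [_|/negbFE/andP[/eqP-> _]].
  by rewrite raddf_sum /=; apply: eq_bigr => t _; rewrite !mevalM.
by rewrite big1 // => t _; rewrite c221 mulr0 mul0r.
Qed.

Lemma meval_gt_p i j : gt12_poly_eq -> (3 <= i)%N -> (1 <= j <= i * p)%N ->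
  (gt_p K n p i j).@[x] = (dbar K n p i j).@[x].
Proof. by case: i => [|[|[|[|i]]]] // ? _; apply: meval_gt_p3. Qed.

(** * The variety and its components as conditions on a point *)

Definition gt3n_vanish := forall i j, (3 <= i <= n)%N ->
  (1 <= j <= i * p)%N -> (gt_p K n p i j).@[x] = 0.

Lemma GT_varietyP : (2 <= n)%N ->
  GT_variety K n p x <-> gt12_poly_eq /\ gt3n_vanish.
Proof.
move=> hn; split=> [V|[eq12 v3] f [i [j [i_range j_range ->]]]].
  have eq12 : gt12_poly_eq.
    apply/dbar12_vanishP => m j m_range j_range.
    by apply: V; exists m, j; split=> //; lia.
  split=> // i j i_range j_range.
  rewrite meval_gt_p //; last by case/andP: i_range.
  by apply: V; exists i, j; split=> //; lia.
have [le_i2|lt_2i] := leqP i 2.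
  by apply: (dbar12_vanishP.2 eq12) => //; lia.
by rewrite -meval_gt_p //; apply: v3 => //; lia.
Qed.

(** One description covers all three cases: the range for $X_{21}$ is empty at [s = 1], the range
    for $X_{12}$ is empty at [s = p + 1], and for [s >= 2] the truncated [p - (s - 2)] equals
    [p + 2 - s]. *)
Lemma GT_componentP s : (1 <= s <= p.+1)%N ->
  GT_component K n p s x <->
  [/\ gt12_vanish, forall i, (s <= i <= p)%N -> c 1 2 i = 0,
      forall i, (p.+2 - s <= i <= p)%N -> c 2 1 i = 0 & gt3n_vanish].
Proof.
move=> s_range; rewrite /GT_component.
case: eqP => [->|/eqP s1]; last case: eqP => [->|/eqP sp].
- split=> [V|[v12 vB vC v3] f [[[i [j [? ? ->]]]|[i ? <-]]|[i [j [? ? ->]]]]].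
  + split=> [i j ? ?|i ?|i ?|i j ? ?].
    * by apply: V; left; left; exists i, j.
    * by apply: V; left; right; exists i.
    * lia.
    * by apply: V; right; exists i, j.
  + exact: v12.
  + exact: vB.
  + exact: v3.
- split=> [V|[v12 vB vC v3] f [[[i [j [? ? ->]]]|[i /= ? <-]]|[i [j [? ? ->]]]]].
  + split=> [i j ? ?|i ?|i ?|i j ? ?].
    * by apply: V; left; left; exists i, j.
    * lia.
    * by apply: V; left; right; exists i => //=; lia.
    * by apply: V; right; exists i, j.
  + exact: v12.
  + by apply: vC; lia.
  + exact: v3.
split=> [V|[v12 vB vC v3] f
    [[[[i [j [? ? ->]]]|[i /= ? <-]]|[i /= ? <-]]|[i [j [? ? ->]]]]].
- split=> [i j ? ?|i ?|i ?|i j ? ?].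
  + by apply: V; left; left; left; exists i, j.
  + by apply: V; left; left; right; exists i.
  + by apply: V; left; right; exists i => //=; lia.
  + by apply: V; right; exists i, j.
- exact: v12.
- exact: vB.
- by apply: vC; lia.
- exact: v3.
Qed.

Lemma low_coef_P12P21P :
  (forall k, (k < p)%N -> (P 1 2 * P 2 1)`_k = 0) <->
  exists2 s, (1 <= s <= p.+1)%N &
    (forall i, (s <= i <= p)%N -> c 1 2 i = 0) /\
    (forall i, (p.+2 - s <= i <= p)%N -> c 2 1 i = 0).
Proof.
split=> [/low_coef_mul_split[b le_b [B0 C0]]|[s s_range [B0 C0]] k lt_k].
  (* The coefficient of degree k is the variable of superscript [p - k]: the first [b] coefficients
     of $P_{12}$ are the superscripts from [p + 1 - b = s] on, and the first [p - b] of $P_{21}$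
     those from [b + 1 = p + 2 - s] on. *)
  exists (p.+1 - b)%N; first lia.
  split=> i i_range.
    by rewrite -(coef_rev_poly_sub (p := p) (c 1 2)) ?B0 //; lia.
  by rewrite -(coef_rev_poly_sub (p := p) (c 2 1)) ?C0 //; lia.
(* The two orders of vanishing add up to [p]. *)
apply: (@coef_mul_low0 _ _ _ (p.+1 - s) (s - 1)); last lia.
  by move=> i lt_i; rewrite coef_rev_poly ?B0 //; lia.
by move=> i lt_i; rewrite coef_rev_poly ?C0 //; lia.
Qed.

End Points.

(** * Decomposition of the variety into the components *)

Theorem proposition4p14 (K : closedFieldType) (charK : [pchar K] =i pred0)
    (n p : nat) (hp : (1 <= p)%N) (hn : (2 <= n)%N) :
  GT_variety K n p =
  \bigcup_(s in [set s : nat | (1 <= s <= p.+1)%N]) GT_component K n p s.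
Proof.
apply/seteqP; split=> x.
  move=> /(GT_varietyP _ hn)[/gt12_poly_eqP[v12 /low_coef_P12P21P[s s_range []]]].
  by move=> B0 C0 v3; exists s => //; apply/GT_componentP.
move=> [s s_range /(GT_componentP _ s_range)[v12 B0 C0 v3]].
apply/(GT_varietyP _ hn); split=> //; apply/gt12_poly_eqP; split=> //.
by apply/low_coef_P12P21P; exists s.
Qed.
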